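(* Let $k$ be an algebraically closed field containing $\kappa$, and let $(A_m\subset\dots\subset A_1\subset B_1\subset\dots\subset B_m)\in\mathcal N^{\mathbf h}_{E/F}(k)$ be any point. Then its Bruhat–Tits type $I\subset\{0,\dots,m\}$ is not empty.
   Context: Fields. $p$ is an odd prime, $F/\mathbb Q_p$ a finite extension with ring of integers $\mathcal O_F$, uniformizer $\pi$, residue field $\mathbb F_q$; $E/F$ is the unramified quadratic extension with nontrivial automorphism $x\mapsto x^*$; $\breve E$ is the completion of the maximal unramified extension of $E$, with residue field $\kappa=\overline{\mathbb F}_{q}$. For a perfect field $R\supset\mathbb F_q$, $W_{\mathcal O_F}(R)$ is the ring of relative Witt vectors, $F_R$ its fraction field, and $\sigma$ the lift of $x\mapsto x^q$. Fix $n,m\ge 1$ and integers $\mathbf h=(h_1<\dots<h_m)$, $0\le h_i\le n$, all of the same parity. Hermitian space. A strict formal $\mathcal O_F$-module is a formal $p$-divisible group with $\mathcal O_F$-action inducing the natural action on its Lie algebra. Fix $\mathbb X^{[h_1]}=(\mathbb X,i_{\mathbb X},\lambda)$: $\mathbb X$ is a supersingular strict formal $\mathcal O_F$-module over $\mathbb F_{q^2}$ of relative $F$-height $2n$; $i_{\mathbb X}$ is an $\mathcal O_E$-action extending the $\mathcal O_F$-action with $\mathrm{charpol}(i_{\mathbb X}(x)\mid \mathrm{Lie}\,\mathbb X)=(T-x)(T-x^* )^{n-1}$; $\lambda:\mathbb X\to\mathbb X^\vee$ is an $\mathcal O_E$-linear polarization ($\mathbb X^\vee$ having the action $i_{\mathbb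 X}(x^* )^\vee$) whose kernel lies in $\mathbb X[\pi]$ and has order $q^{2h_1}$. Let $\mathbb N$ be its rational relative Dieudonné module, with Frobenius $\mathcal F$ and Verschiebung $\mathcal V$ ($\mathcal F\mathcal V=\pi$), and pairing $\langle\cdot,\cdot\rangle$ induced by $\lambda$, with $\langle\mathcal Fv,w\rangle=\langle v,\mathcal Vw\rangle^\sigma$ and $\langle i_{\mathbb X}(x)v,w\rangle=\langle v,i_{\mathbb X}(x^* )w\rangle$. For $k\supset\kappa$ algebraically closed, $\mathbb N_k=\mathbb N\otimes F_k=\mathbb N_{k,0}\oplus\mathbb N_{k,1}$, where $E$ acts on $\mathbb N_{k,0}$ via a fixed $F$-isomorphism $\varphi_0:E\simeq F_{\mathbb F_{q^2}}$ and on $\mathbb N_{k,1}$ via its conjugate. Put $\tau=\pi\mathcal V^{-2}$ and $C=\mathbb N_{k,0}^{\tau}$, an $n$-dimensional $F_{\mathbb F_{q^2}}$-space independent of $k$ with $C_k:=C\otimes F_k=\mathbb N_{k,0}$ and $\tau=\mathrm{id}\otimes\sigma^2$. The form $\{v,w\}=\delta\langle v,\mathcal Fw\rangle$ (with fixed $\delta\in W_{\mathcal O_F}(\mathbb F_{q^2})^\times$, $\delta^\sigma=-\delta$) is left linear, right $\sigma$-linear, nondegenerate on $C_k$, and hermitian on $C$. For a lattice $A$ in $C_k$ (over $W_{\mathcal O_F}(k)$) or in $C$ (over $W_{\mathcal O_F}(\mathbb F_{q^2})$), $A^\vee$ is the set of $v$ such that $\{v,A\}$ is integral; one has $(A^\vee)^\vee=\tau(A)$.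 $A\overset{x}{\subset}B$ means $A\subset B$ with $B/A$ of length $x$. Points. $\mathcal N^{\mathbf h}_{E/F}(k)$ (the $k$-points of the basic unramified unitary Rapoport–Zink space of signature $(1,n-1)$ and level $\mathbf h$) is identified with the set of chains of $W_{\mathcal O_F}(k)$-lattices $A_m\subset\dots\subset A_1\subset B_1\subset\dots\subset B_m$ in $C_k$ such that for all $1\le i\le m$: $\pi A_i^\vee\overset{1}{\subset}B_i\subset A_i^\vee$, $\pi B_i^\vee\overset{1}{\subset}A_i\subset B_i^\vee$, and $\pi B_i\subset A_i\overset{h_i}{\subset}B_i$. Vertex lattices. For $i\in\mathbb Z$, $\mathcal L_i$ is the set of $W_{\mathcal O_F}(\mathbb F_{q^2})$-lattices $\Lambda\subset C$ with $\pi^{i+1}\Lambda^\vee\subset\Lambda\subset\pi^i\Lambda^\vee$. Bruhat–Tits type. For a lattice $M\subset C_k$ put $T_s(M)=M+\tau(M)+\dots+\tau^{s-1}(M)$; for the $A_i,B_i$ above this is $\tau$-stable for $s$ large. Let $\Lambda_{A_i},\Lambda_{B_i}\subset C$ be the $W_{\mathcal O_F}(\mathbb F_{q^2})$-lattices with $\Lambda_{A_i}\otimes W_{\mathcal O_F}(k)=T_s(A_i)$ and $\Lambda_{B_i}\otimes W_{\mathcal O_F}(k)=T_s(B_i)$ for $s$ large. The Bruhat–Tits type of the point is the subset $I\subset\{0,\dots,m\}$ such that: $0\in I$ iff $\Lambda_{A_1}\in\mathcal L_1$; $m\in I$ iff $\Lambda_{B_m}\in\mathcal L_0$; and for $1\le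 i\le m-1$, $i\in I$ iff $\Lambda_{B_i}\subset\pi\Lambda_{A_{i+1}}^\vee$. *)

(* Defs.v *)
(* Mathematical Components, with the classical sets of MathComp-Analysis.
   Rings of integers, lattices and other modules are sets inside an ambient
   field or vector space. *)
From HB Require Import structures.
From mathcomp Require Import all_boot all_order all_algebra all_field.
From mathcomp Require Import boolp classical_sets.

Set Implicit Arguments.
Unset Strict Implicit.
Unset Printing Implicit Defensive.

Import GRing.Theory.
Local Open Scope classical_set_scope.
Local Open Scope ring_scope.

Section Rings.
Variables (K k : fieldType) (O : set K) (pi : K) (red : K -> k).

Record is_subring : Prop := {
  subring1 : O 1;
  subringB : forall x y, O x -> O y -> O (x - y);
  subringM : forall x y, O x -> O y -> O (x * y) }.

(* red is only meaningful on O; it identifies O / pi O with k. *)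
Record is_residue_map : Prop := {
  residue_subring : is_subring;
  residue_pi : O pi;
  residue1 : red 1 = 1;
  residueD : forall x y, O x -> O y -> red (x + y) = red x + red y;
  residueM : forall x y, O x -> O y -> red (x * y) = red x * red y;
  residue_surj : forall a, exists2 x, O x & red x = a;
  residue_ker : forall x, O x -> (red x = 0 <-> exists2 y, O y & x = pi * y) }.

(* O is pi-torsion free, pi-adically separated and complete, with
   O / pi O = k, and K = O[1/pi]. *)
Record is_strict_ring : Prop := {
  strict_residue : is_residue_map;
  strict_pi : pi != 0;
  strict_frac : forall x, exists i : nat, O (pi ^+ i * x);
  strict_separated : forall x, (forall i : nat, O (x / pi ^+ i)) -> x = 0;
  strict_complete : forall u : nat -> K,
    (forall i, O (u i)) -> (forall i, O ((u i.+1 - u i) / pi ^+ i)) ->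
    exists2 l, O l & forall i, O ((l - u i) / pi ^+ i) }.

End Rings.

Definition integral_closure (K : fieldType) (O : set K) (L : fieldExtType K) :
    set L :=
  [set x | exists P : {poly K}, [/\ P \is monic, forall i, O P`_i &
                                    root (map_poly (in_alg L) P) x]].

Arguments integral_closure {K} O L _.

(* A finite extension F of Q_p, where Q_p is the fraction field of the strict
   p-ring with residue field F_p. *)
Record padicField (p : nat) := PadicField {
  Qp : fieldType;
  Zp : set Qp;
  redp : Qp -> 'F_p;
  Zp_strict : is_strict_ring Zp p%:R redp;
  pF :> fieldExtType Qp;
  unif : pF;
  resF : finFieldType;
  redF : pF -> resF;
  redF_residue : is_residue_map (integral_closure Zp pF) unif redF }.

Definition intF (p : nat) (F : padicField p) : set F :=
  integral_closure (@Zp p F) F.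
Arguments intF {p} F _.

(* Unramified: a uniformizer of F is still a uniformizer of E. *)
Record unramifiedQuadratic (p : nat) (F : padicField p) := UnramifiedQuadratic {
  qE :> fieldExtType F;
  qE_dim : (\dim {:qE} = 2)%N;
  resE : finFieldType;
  redE : qE -> resE;
  redE_residue :
    is_residue_map (integral_closure (intF F) qE) (unif F)%:A redE;
  star : {rmorphism qE -> qE};
  star_fix : forall a : F, star a%:A = a%:A;
  star_nontrivial : exists x, star x != x }.
Arguments star {p F} _.

Definition intE (p : nat) (F : padicField p) (E : unramifiedQuadratic F) :
  set E := integral_closure (intF F) E.
Arguments intE {p F} E _.

(* W_{O_F}(R) for a perfect field R over F_q, as the unique pi-torsion free,
   pi-adically complete O_F-algebra with W / pi W = R; the carrier is its
   fraction field F_R, and wfrob is the lift sigma of x |-> x^q. *)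
Record wittVectors (p : nat) (F : padicField p) (R : fieldType)
    (e : resF F -> R) := WittVectors {
  wfield :> fieldType;
  wint : set wfield;
  wred : wfield -> R;
  wstr : {rmorphism F -> wfield};
  wfrob : {rmorphism wfield -> wfield};
  wint_strict : is_strict_ring wint (wstr (unif F)) wred;
  wstr_int : forall x, intF F x -> wint (wstr x);
  wstr_red : forall x, intF F x -> wred (wstr x) = e (redF x);
  wfrob_int : forall x, wint x -> wint (wfrob x);
  wfrob_red : forall x, wint x -> wred (wfrob x) = wred x ^+ #|resF F|;
  wfrob_str : forall x, wfrob (wstr x) = wstr x }.
Arguments wint {p F R e} _ _.

Definition wpi (p : nat) (F : padicField p) (R : fieldType)
  (e : resF F -> R) (W : wittVectors e) : W := wstr W (unif F).

(* The map of Witt vectors functorially induced by f. *)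
Record wittMap (p : nat) (F : padicField p) (R1 R2 : fieldType)
    (e1 : resF F -> R1) (e2 : resF F -> R2) (f : R1 -> R2)
    (W1 : wittVectors e1) (W2 : wittVectors e2) := WittMap {
  wmap :> {rmorphism W1 -> W2};
  wmap_int : forall x, wint W1 x -> wint W2 (wmap x);
  wmap_red : forall x, wint W1 x -> wred (wmap x) = f (wred x);
  wmap_str : forall x, wmap (wstr W1 x) = wstr W2 x;
  wmap_frob : forall x, wmap (wfrob W1 x) = wfrob W2 (wmap x) }.

Section Modules.
Variables (K : fieldType) (V : vectType K).
Implicit Types (R S : set K) (X A B : set V).

Definition rspan R (b : seq V) : set V :=
  [set v | exists2 a : nat -> K, (forall i, R (a i)) &
           v = \sum_(i < size b) a i *: b`_i].

(* For S a subfield of K: b is an S-basis of X. *)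
Definition is_basis S X (b : seq V) : Prop :=
  X = rspan S b /\
  (forall a : nat -> K, (forall i, S (a i)) ->
     \sum_(i < size b) a i *: b`_i = 0 -> forall i, (i < size b)%N -> a i = 0).

(* For S a subfield of K with ring of integers R: A is an R-lattice in the
   S-vector space X. *)
Definition is_lattice R S X A : Prop :=
  exists2 b : seq V, is_basis S X b & A = rspan R b.

Definition is_submodule R A : Prop :=
  [/\ A 0, forall v w, A v -> A w -> A (v + w) &
           forall a v, R a -> A v -> A (a *: v)].

(* A is contained in B and the R-module B / A has a composition series of
   length x. *)
Definition colength R (x : nat) A B : Prop :=
  exists M : nat -> set V,
    [/\ M 0%N = A, M x = B, forall i, (i <= x)%N -> is_submodule R (M i) &
        forall i, (i < x)%N ->
          [/\ M i `<=` M i.+1, M i <> M i.+1 &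
              forall L, is_submodule R L -> M i `<=` L -> L `<=` M i.+1 ->
                L = M i \/ L = M i.+1]].

Definition scale_set (c : K) A : set V := [set c *: v | v in A].

(* The R-submodule generated by A. *)
Definition rgen R A : set V :=
  [set v | exists2 b : seq V, (forall w, w \in b -> A w) & rspan R b v].

End Modules.

(* The relative Dieudonne module N of the framing object X^[h], with the
   (covariant) Dieudonne lattice dM of X, so that Lie X = dM / V dM. *)
Record framing (p : nat) (F : padicField p) (E : unramifiedQuadratic F)
    (R : fieldType) (e : resF F -> R) (W : wittVectors e)
    (phi0 : E -> W) (n h : nat) := Framing {
  dN :> vectType W;
  dN_dim : (\dim (fullv : {vspace dN}) = 2 * n)%N;
  dF : dN -> dN;
  dFD : forall v w, dF (v + w) = dF v + dF w;
  dFZ : forall a v, dF (a *: v) = wfrob W a *: dF v;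
  dV : dN -> dN;
  dVD : forall v w, dV (v + w) = dV v + dV w;
  dVZ : forall a v, dV (wfrob W a *: v) = a *: dV v;
  dFV : forall v, dF (dV v) = wpi W *: v;
  dVF : forall v, dV (dF v) = wpi W *: v;
  dE : E -> dN -> dN;
  dED : forall x v w, dE x (v + w) = dE x v + dE x w;
  dEZ : forall x a v, dE x (a *: v) = a *: dE x v;
  dE_add : forall x y v, dE (x + y) v = dE x v + dE y v;
  dE_mul : forall x y v, dE (x * y) v = dE x (dE y v);
  dE_str : forall (a : F) v, dE a%:A v = wstr W a *: v;
  dE_F : forall x v, dE x (dF v) = dF (dE x v);
  dE_V : forall x v, dE x (dV v) = dV (dE x v);
  dpair : dN -> dN -> W;
  dpair_linl : forall a v w u, dpair (a *: v + w) u = a * dpair v u + dpair w u;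
  dpair_linr : forall a v w u, dpair u (a *: v + w) = a * dpair u v + dpair u w;
  dpair_alt : forall v, dpair v v = 0;
  dpair_nondeg : forall v, (forall w, dpair v w = 0) -> v = 0;
  dpair_FV : forall v w, dpair (dF v) w = wfrob W (dpair v (dV w));
  dpair_E : forall x v w, dpair (dE x v) w = dpair v (dE (star E x) w);
  dM : set dN;
  dM_lattice : is_lattice (wint W) setT setT dM;
  dM_F : forall v, dM v -> dM (dF v);
  dM_V : forall v, dM v -> dM (dV v);
  dM_E : forall x v, intE E x -> dM v -> dM (dE x v);
  (* supersingular: all slopes are 1/2 *)
  dN_supersingular : exists2 L, is_lattice (wint W) setT setT L &
    [set dV (dV v) | v in L] = scale_set (wpi W) L;
  (* charpol (x | Lie X) = (T - x) (T - x^* )^(n-1): lie presents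
     dM / V dM as R^d, on which x acts by the matrix act x *)
  dN_signature : exists (d : nat) (lie : dN -> 'rV[R]_d) (act : E -> 'M[R]_d),
    [/\ forall v w, dM v -> dM w -> lie (v + w) = lie v + lie w,
        forall a v, wint W a -> dM v -> lie (a *: v) = wred a *: lie v,
        forall y, exists2 v, dM v & lie v = y,
        forall v, dM v -> (lie v = 0 <-> exists2 w, dM w & v = dV w) &
        forall x, intE E x ->
          (forall v, dM v -> lie (dE x v) = lie v *m act x) /\
          char_poly (act x) = ('X - (wred (phi0 x))%:P)
                            * ('X - (wred (phi0 (star E x)))%:P) ^+ n.-1];
  (* the dual of dM is the Dieudonne lattice of X^vee; the conditions on
     ker lambda read: killed by pi, of length 2h *)
  dM_polarized :
    let Md := [set v | forall w, dM w -> wint W (dpair v w)] in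
    colength (wint W) (2 * h) dM Md /\ scale_set (wpi W) Md `<=` dM }.

(* N_k = N (x) F_k with the extended operators and pairing. *)
Record framingBC (p : nat) (F : padicField p) (E : unramifiedQuadratic F)
    (R k : fieldType) (e : resF F -> R) (W : wittVectors e)
    (phi0 : E -> W) (n h : nat) (X : framing phi0 n h)
    (ek : resF F -> k) (Wk : wittVectors ek) (f : R -> k)
    (j : wittMap f W Wk) := FramingBC {
  bN :> vectType Wk;
  bc : X -> bN;
  bcD : forall v w, bc (v + w) = bc v + bc w;
  bcZ : forall a v, bc (a *: v) = j a *: bc v;
  bc_basis : forall b : seq X,
    basis_of fullv b -> basis_of fullv (map bc b);
  bF : bN -> bN;
  bFD : forall v w, bF (v + w) = bF v + bF w;
  bFZ : forall a v, bF (a *: v) = wfrob Wk a *: bF v;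
  bF_bc : forall v, bF (bc v) = bc (dF v);
  bV : bN -> bN;
  bVD : forall v w, bV (v + w) = bV v + bV w;
  bVZ : forall a v, bV (wfrob Wk a *: v) = a *: bV v;
  bV_bc : forall v, bV (bc v) = bc (dV v);
  bE : E -> bN -> bN;
  bED : forall x v w, bE x (v + w) = bE x v + bE x w;
  bEZ : forall x a v, bE x (a *: v) = a *: bE x v;
  bE_bc : forall x v, bE x (bc v) = bc (dE x v);
  bpair : bN -> bN -> Wk;
  bpair_linl : forall a v w u, bpair (a *: v + w) u = a * bpair v u + bpair w u;
  bpair_linr : forall a v w u, bpair u (a *: v + w) = a * bpair u v + bpair u w;
  bpair_bc : forall v w, bpair (bc v) (bc w) = j (dpair v w) }.

Section Hermitian.
Variables (p : nat) (F : padicField p) (E : unramifiedQuadratic F).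
Variables (R k : fieldType) (e : resF F -> R) (W : wittVectors e).
Variables (phi0 : E -> W) (n h1 : nat) (X : framing phi0 n h1).
Variables (ek : resF F -> k) (Wk : wittVectors ek) (f : R -> k).
Variables (j : wittMap f W Wk) (N : framingBC X j) (delta : W).
Implicit Types (A B M Lam S : set N).

(* Inside F_k: W_{O_F}(k), F_R and W_{O_F}(R). *)
Let Ok : set Wk := wint Wk.
Let FR : set Wk := range j.
Let OR : set Wk := j @` wint W.

(* C_k is N_{k,0}. *)
Definition Ck : set N := [set v | forall x : E, bE x v = j (phi0 x) *: v].

(* As F V = pi, the inverse of V is pi^-1 F. *)
Definition invV (v : N) : N := (wpi Wk)^-1 *: bF v.
Definition tau (v : N) : N := wpi Wk *: invV (invV v).

Definition C : set N := [set v | Ck v /\ tau v = v].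

Definition herm (v w : N) : Wk := j delta * bpair v (bF w).

(* Duals of lattices in C_k (S = Ck) and in C (S = C). *)
Definition dual S A : set N := [set v | S v /\ forall w, A w -> Ok (herm v w)].

Definition latticeCk A : Prop := is_lattice Ok setT Ck A.
Definition latticeC Lam : Prop := is_lattice OR FR C Lam.

(* The chain is indexed by 1, ..., m; values of h, A, B at other indices are
   irrelevant. *)
Record is_point (m : nat) (h : nat -> nat) (A B : nat -> set N) : Prop := {
  point_lattice : forall i, (1 <= i <= m)%N ->
    latticeCk (A i) /\ latticeCk (B i);
  point_chain : forall i, (1 <= i < m)%N ->
    A i.+1 `<=` A i /\ B i `<=` B i.+1;
  point_dualA : forall i, (1 <= i <= m)%N ->
    colength Ok 1%N (scale_set (wpi Wk) (dual Ck (A i))) (B i) /\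
    B i `<=` dual Ck (A i);
  point_dualB : forall i, (1 <= i <= m)%N ->
    colength Ok 1%N (scale_set (wpi Wk) (dual Ck (B i))) (A i) /\
    A i `<=` dual Ck (B i);
  point_level : forall i, (1 <= i <= m)%N ->
    scale_set (wpi Wk) (B i) `<=` A i /\ colength Ok (h i) (A i) (B i) }.

Definition vertex (i : int) Lam : Prop :=
  [/\ latticeC Lam, scale_set (wpi Wk ^ (i + 1)) (dual C Lam) `<=` Lam &
      Lam `<=` scale_set (wpi Wk ^ i) (dual C Lam)].

Definition T (s : nat) M : set N :=
  [set v | exists2 u : nat -> N,
     forall i, (i < s)%N -> (iter i tau @` M) (u i) & v = \sum_(i < s) u i].

Definition is_Lambda M Lam : Prop :=
  latticeC Lam /\
  exists s0, forall s, (s0 <= s)%N -> rgen Ok Lam = T s M.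

Definition is_BT_type (m : nat) (A B : nat -> set N) (I : {set 'I_m.+1}) :
    Prop :=
  exists LA LB : nat -> set N,
    [/\ forall i, (1 <= i <= m)%N -> is_Lambda (A i) (LA i) /\
                                     is_Lambda (B i) (LB i),
        ord0 \in I <-> vertex 1 (LA 1%N),
        ord_max \in I <-> vertex 0 (LB m) &
        forall i : 'I_m.+1, (1 <= i < m)%N ->
          (i \in I <->
           LB i `<=` scale_set (wpi Wk) (dual C (LA i.+1)))].

End Hermitian.

(* Main.v *)
(** Put T(M) for the tau-stable lattice generated by M, and extend the chain by
    B_0 := A_1 and A_(m+1) := pi B_m.  Every index i in {0, ..., m} then belongs
    to I as soon as {T(B_i), T(A_(i+1))} is contained in pi O.  Suppose that this
    fails for all i.  Each inclusion pi A^v < B, pi B^v < A of length one makes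
    tau B / pi A^v and tau A / pi B^v simple, and with the failure at i this gives
    T(B_(i+1)) = B_(i+1) + T(B_i) and T(A_i) = A_i + T(A_(i+1)).  Hence
    T(B_m) = B_m + T(A_1) = B_m + pi T(B_m), so that B_m, and then every lattice
    of the chain, is tau-stable by Nakayama.  In that case
    B_i = pi A_i^v + O v for some v in B_(i-1), so that if {B_i, B_i} is not
    integral then neither is {v, v}: starting from the failure at m one descends
    to {A_1, A_1} not integral, which contradicts A_1 < B_1 < A_1^v. *)
Require Import Defs.
From HB Require Import structures.
From mathcomp Require Import all_boot all_order all_algebra all_field.
From mathcomp Require Import boolp classical_sets.
From mathcomp Require Import ring.

Set Implicit Arguments.
Unset Strict Implicit.
Unset Printing Implicit Defensive.

Import GRing.Theory.
Local Open Scope ring_scope.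

(** * Submodules of a vector space over a subring, and quotients of length one *)

Section Submodules.
Local Open Scope classical_set_scope.
Variables (K : fieldType) (R : set K) (V : vectType K).
Hypothesis subR : is_subring R.
Implicit Types (M X Y : set V).

Lemma subring0 : R 0.
Proof. by rewrite -(subrr 1); apply: (subringB subR); apply: subring1. Qed.

Lemma subringN x : R x -> R (- x).
Proof. by move=> Rx; rewrite -sub0r; apply: (subringB subR) => //; apply: subring0. Qed.

Lemma subringD x y : R x -> R y -> R (x + y).
Proof.
by move=> Rx Ry; rewrite -[y]opprK; apply: (subringB subR) => //; apply: subringN.
Qed.

Lemma subringX x i : R x -> R (x ^+ i).
Proof.
move=> Rx; elim: i => [|i IHi]; first by rewrite expr0; apply: subring1.
by rewrite exprS; apply: subringM.
Qed.

Lemma submodule0 M : is_submodule R M -> M 0. Proof. by case. Qed.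

Lemma submoduleD M v w : is_submodule R M -> M v -> M w -> M (v + w).
Proof. by case=> _ + _; apply. Qed.

Lemma submoduleZ M a v : is_submodule R M -> R a -> M v -> M (a *: v).
Proof. by case=> _ _; apply. Qed.

Lemma submoduleB M v w : is_submodule R M -> M v -> M w -> M (v - w).
Proof.
move=> subM Mv Mw; apply: submoduleD => //; rewrite -scaleN1r.
by apply: submoduleZ => //; apply: subringN; apply: subring1.
Qed.

Lemma submodule_sum M (r : nat) (u : nat -> V) :
  is_submodule R M -> (forall i, (i < r)%N -> M (u i)) ->
  M (\sum_(i < r) u i).
Proof.
move=> subM; elim: r => [|r IHr] Mu; first by rewrite big_ord0; apply: submodule0.
rewrite big_ord_recr /=; apply: submoduleD => //; last exact: Mu.
by apply: IHr => i /ltnW; apply: Mu.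
Qed.

Lemma rspan_submodule (b : seq V) : is_submodule R (rspan R b).
Proof.
split.
- exists (fun _ => 0); first by move=> _; apply: subring0.
  by rewrite big1 // => i _; rewrite scale0r.
- move=> _ _ [a Ra ->] [c Rc ->]; exists (fun i => a i + c i).
    by move=> i; apply: subringD.
  by rewrite -big_split /=; apply: eq_bigr => i _; rewrite scalerDl.
- move=> c _ Rc [a Ra ->]; exists (fun i => c * a i).
    by move=> i; apply: subringM.
  by rewrite scaler_sumr; apply: eq_bigr => i _; rewrite scalerA.
Qed.

Lemma rspan_sub M (b : seq V) :
  is_submodule R M -> (forall w, w \in b -> M w) -> rspan R b `<=` M.
Proof.
move=> subM Mb _ [a Ra ->]; apply: (submodule_sum (u := fun i => a i *: b`_i)) => // i lti.
by apply: submoduleZ => //; apply: Mb; rewrite mem_nth.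
Qed.

Lemma rspan_mem (b : seq V) w : w \in b -> rspan R b w.
Proof.
move=> bw; exists (fun i => (i == index w b)%:R).
  by move=> i; case: eqP => _; [apply: subring1 | apply: subring0].
have ltw : (index w b < size b)%N by rewrite index_mem.
rewrite (bigD1 (Ordinal ltw)) //= eqxx scale1r nth_index // big1 ?addr0 // => i nei.
case: eqP => [eqi|_]; last by rewrite scale0r.
by case/eqP: nei; apply: val_inj.
Qed.

Lemma rgen_incl X : X `<=` rgen R X.
Proof.
move=> v Xv; exists [:: v]; first by move=> w; rewrite inE => /eqP->.
by apply: rspan_mem; rewrite inE.
Qed.

Lemma rgen_sub X M : is_submodule R M -> X `<=` M -> rgen R X `<=` M.
Proof.
by move=> subM XM v [b Xb]; apply: rspan_sub => // w /Xb/XM.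
Qed.

Lemma rgen_submodule X : is_submodule R (rgen R X).
Proof.
split.
- by exists [::] => //; apply: submodule0; apply: rspan_submodule.
- move=> v w [b Xb bv] [c Xc cw]; exists (b ++ c).
    by move=> u; rewrite mem_cat => /orP[/Xb|/Xc].
  apply: submoduleD; first exact: rspan_submodule.
    apply: rspan_sub bv; first exact: rspan_submodule.
    by move=> u bu; apply: rspan_mem; rewrite mem_cat bu.
  apply: rspan_sub cw; first exact: rspan_submodule.
  by move=> u cu; apply: rspan_mem; rewrite mem_cat cu orbT.
- move=> a v Ra [b Xb bv]; exists b => //.
  by apply: submoduleZ => //; apply: rspan_submodule.
Qed.

Lemma scale_submodule c M : is_submodule R M -> is_submodule R (scale_set c M).
Proof.
move=> subM; split.
- by exists 0; rewrite ?scaler0 //; apply: submodule0.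
- move=> _ _ [v Mv <-] [w Mw <-]; exists (v + w); last by rewrite scalerDr.
  exact: submoduleD.
- move=> a _ Ra [v Mv <-]; exists (a *: v); first exact: submoduleZ.
  by rewrite !scalerA mulrC.
Qed.

Definition sum_set X Y : set V :=
  [set v | exists2 x, X x & exists2 y, Y y & v = x + y].

Lemma sum_submodule X Y :
  is_submodule R X -> is_submodule R Y -> is_submodule R (sum_set X Y).
Proof.
move=> subX subY; split.
- exists 0; first exact: submodule0.
  by exists 0; rewrite ?addr0 //; apply: submodule0.
- move=> _ _ [x Xx [y Yy ->]] [x' Xx' [y' Yy' ->]].
  exists (x + x'); first exact: submoduleD.
  by exists (y + y'); [apply: submoduleD | rewrite addrACA].
- move=> a _ Ra [x Xx [y Yy ->]]; exists (a *: x); first exact: submoduleZ.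
  by exists (a *: y); [apply: submoduleZ | rewrite scalerDr].
Qed.

Lemma sum_subl X Y : is_submodule R Y -> X `<=` sum_set X Y.
Proof.
by move=> subY x Xx; exists x => //; exists 0; rewrite ?addr0 //; apply: submodule0.
Qed.

Lemma sum_subr X Y : is_submodule R X -> Y `<=` sum_set X Y.
Proof.
by move=> subX y Yy; exists 0; [apply: submodule0 | exists y; rewrite ?add0r].
Qed.

Lemma sum_sub X Y M : is_submodule R M -> X `<=` M -> Y `<=` M -> sum_set X Y `<=` M.
Proof.
by move=> subM XM YM _ [x /XM Mx [y /YM My ->]]; apply: submoduleD.
Qed.

Lemma colength_sub x X Y : colength R x X Y -> X `<=` Y.
Proof.
case=> M [<- <- _ chM].
elim: x chM => [|x IHx] chM; first exact: subset_refl.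
have [MS _ _] := chM x (leqnn _).
by apply: subset_trans MS; apply: IHx => i /leqW; apply: chM.
Qed.

(** [X + R y] lies between [X] and [Y] and differs from [X], so it is all of [Y] because [Y / X] is
    simple. *)
Lemma colength1_gen X Y y z :
  colength R 1 X Y -> Y y -> ~ X y -> Y z ->
  exists2 x, X x & exists2 a, R a & z = x + a *: y.
Proof.
case=> M [<- <- subM /(_ 0%N isT) [M01 _ maxM]] Yy Xy Yz.
have sub0 := subM 0%N isT; have sub1 := subM 1%N isT.
pose L := sum_set (M 0%N) (rspan R [:: y]).
have subL : is_submodule R L by apply: sum_submodule => //; apply: rspan_submodule.
have yL : L y.
  by apply: sum_subr => //; apply: rspan_mem; rewrite inE.
have LY : L `<=` M 1%N.
  by apply: sum_sub => //; apply: rspan_sub => // w; rewrite inE => /eqP->.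
have XL : M 0%N `<=` L by apply: sum_subl; apply: rspan_submodule.
have [eqL|eqL] := maxM L subL XL LY; first by case: Xy; rewrite -eqL.
move: Yz; rewrite -eqL => -[x Xx [_ [a Ra ->] ->]].
exists x => //; exists (a 0%N) => //.
by rewrite big_ord_recl big_ord0 addr0.
Qed.

End Submodules.

(** * Chains of modules with a sesquilinear form, over an algebraically closed residue field *)

Section SemilinearChain.
Local Open Scope classical_set_scope.
Variables (K : fieldType) (k : closedFieldType) (O : set K) (pi : K).
Variables (red : K -> k) (s : {rmorphism K -> K}) (q : nat).
Hypotheses (resO : is_residue_map O pi red) (pi_neq0 : pi != 0).
Hypotheses (q_gt0 : (0 < q)%N) (s_int : forall x, O x -> O (s x)).
Hypothesis s_red : forall x, O x -> red (s x) = red x ^+ q.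
Hypothesis s_pi : s pi = pi.
Variables (V : vectType K) (tau : V -> V) (U : set V) (H : V -> V -> K).
Hypothesis tauD : forall v w, tau (v + w) = tau v + tau w.
Hypothesis tauZ : forall a v, tau (a *: v) = s (s a) *: tau v.
Hypothesis subU : is_submodule setT U.
Hypothesis HDl : forall v w u, H (v + w) u = H v u + H w u.
Hypothesis HZl : forall a v u, H (a *: v) u = a * H v u.
Hypothesis HDr : forall v w u, H u (v + w) = H u v + H u w.
Hypothesis HZr : forall a v u, H u (a *: v) = s a * H u v.
Hypothesis Htau : forall v w, H (tau v) w = s (H w v).

Let subO : is_subring O := residue_subring resO.

Definition pi_ideal (x : K) := exists2 y, O y & x = pi * y.

Lemma pi_idealD x y : pi_ideal x -> pi_ideal y -> pi_ideal (x + y).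
Proof.
by case=> a Oa -> [b Ob ->]; exists (a + b); [apply: subringD | rewrite mulrDr].
Qed.

Lemma pi_idealM a x : O a -> pi_ideal x -> pi_ideal (a * x).
Proof.
by move=> Oa [b Ob ->]; exists (a * b); [apply: (subringM subO) | rewrite mulrCA].
Qed.

Lemma pi_ideal0 : pi_ideal 0.
Proof. by exists 0; [apply: subring0 | rewrite mulr0]. Qed.

Lemma pi_idealS x : pi_ideal x -> pi_ideal (s x).
Proof. by case=> a Oa ->; exists (s a); rewrite ?rmorphM ?s_pi //; apply: s_int. Qed.

Lemma subring_pi_ideal x : pi_ideal (pi * x) -> O x.
Proof. by case=> y Oy /(mulfI pi_neq0) ->. Qed.

Definition hdual (A : set V) : set V := [set v | U v /\ forall w, A w -> O (H v w)].

Lemma scale_hdualP A v :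
  scale_set pi (hdual A) v <-> U v /\ forall w, A w -> pi_ideal (H v w).
Proof.
split=> [[w [Uw Aw] <-]|[Uv Av]].
  split; first exact: (submoduleZ subU).
  by move=> u Au; rewrite HZl; exists (H w u) => //; apply: Aw.
exists (pi^-1 *: v); last by rewrite scalerA divff ?scale1r.
split; first exact: (submoduleZ subU).
by move=> w /Av [y Oy Hvw]; rewrite HZl Hvw mulKf.
Qed.

Definition tau_closed (Y : set V) := forall v, Y v -> Y (tau v).

(** On a combination of fixed vectors [tau] only changes the coefficients, by [s] applied twice, and
    [s] preserves [O]. *)
Lemma rgen_tau_closed L : (forall v, L v -> tau v = v) -> tau_closed (rgen O L).
Proof.
move=> Lfix v [b Lb [a Oa ->]].
have tau_sum r : tau (\sum_(i < r) a i *: b`_i) = \sum_(i < r) s (s (a i)) *: tau b`_i.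
  elim: r => [|r IHr]; last by rewrite !big_ord_recr /= tauD tauZ IHr.
  by rewrite !big_ord0; apply: (addIr (tau 0)); rewrite -tauD !add0r.
exists b => //; exists (fun i => s (s (a i))); first by move=> i; do 2!apply: s_int.
rewrite tau_sum; apply: eq_bigr => i _; rewrite Lfix //; apply: Lb.
exact: mem_nth.
Qed.

(* rgen O L is T_s(Z) for s large, seen as the smallest tau-closed submodule
   containing Z; it is generated by vectors fixed by tau. *)
Record tau_hull (Z L : set V) : Prop := {
  hull_U : L `<=` U;
  hull_fix : forall v, L v -> tau v = v;
  hull_incl : Z `<=` rgen O L;
  hull_min : forall Y, is_submodule O Y -> Z `<=` Y -> tau_closed Y ->
    rgen O L `<=` Y }.

(** The conditions on a point at one index, apart from the level condition. They are symmetric in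
    [A] and [B], so that results on [B] transfer to [A]. *)
Record dual_pair (A B : set V) : Prop := {
  pair_subA : is_submodule O A;
  pair_subB : is_submodule O B;
  pair_lenA : colength O 1 (scale_set pi (hdual A)) B;
  pair_lenB : colength O 1 (scale_set pi (hdual B)) A;
  pair_leA : B `<=` hdual A;
  pair_leB : A `<=` hdual B }.

Lemma dual_pairC A B : dual_pair A B -> dual_pair B A.
Proof. by case. Qed.

Lemma hull_in_U Z L : tau_hull Z L -> rgen O L `<=` U.
Proof.
move=> hullL; apply: (rgen_sub _ (hull_U hullL)).
by case: subU => ? ? UZ; split=> // a v _; apply: UZ.
Qed.

(** Multiplication by [pi] commutes with [tau] because [s] fixes [pi]; minimality is tested on the
    preimage of [Y] under it. *)
Lemma tau_hull_scale Z L :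
  tau_hull Z L -> tau_hull (scale_set pi Z) (scale_set pi L).
Proof.
move=> hullL; have subL := rgen_submodule subO (scale_set pi L).
have preim (M : set V) : is_submodule O M -> is_submodule O [set v | M (pi *: v)].
  move=> subM; split=> /= [|v w Mv Mw|a v Oa Mv].
  - by rewrite scaler0; apply: submodule0 subM.
  - by rewrite scalerDr; apply: (submoduleD subM).
  - by rewrite scalerA mulrC -scalerA; apply: (submoduleZ subM).
split.
- by move=> _ [v Lv <-]; apply: (submoduleZ subU) => //; apply: (hull_U hullL Lv).
- by move=> _ [v Lv <-]; rewrite tauZ !s_pi (hull_fix hullL).
- move=> _ [v /(hull_incl hullL) Lv <-].
  apply: (rgen_sub (M := [set w | rgen O (scale_set pi L) (pi *: w)]) _ _ Lv).
    exact: preim.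
  move=> w Lw /=.
  by apply: rgen_incl => //; exists w.
- move=> Y subY ZY tauY; apply: (rgen_sub subY) => _ [v Lv <-].
  have ZY' : Z `<=` [set w | Y (pi *: w)] by move=> w Zw; apply: ZY; exists w.
  suff /(hull_min hullL (preim _ subY) ZY') : tau_closed [set w | Y (pi *: w)].
    by apply; apply: rgen_incl.
  by move=> w /= /tauY; rewrite tauZ !s_pi.
Qed.

(* tau v lies in pi A^v iff H a v is in pi O, for any a spanning A / pi B^v; as
   red c ^+ q takes every value, a semilinear combination of v and v' does so. *)
Lemma tau_sub_sum A B Y v' :
  dual_pair A B -> is_submodule O Y -> (forall v, B v -> U (tau v)) ->
  B v' -> Y (tau v') -> ~ scale_set pi (hdual A) (tau v') ->
  forall v, B v -> sum_set B Y (tau v).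
Proof.
move=> AB subY UtauB Bv' Yv' /scale_hdualP nAv' v Bv.
have [a Aa nav'] : exists2 a, A a & ~ pi_ideal (H a v').
  apply: contrapT => na; apply: nAv'; split; first exact: UtauB.
  move=> a Aa; rewrite Htau; apply: pi_idealS.
  by apply: contrapT => nav'; apply: na; exists a.
have OH u : B u -> O (H a u) by have [_] := pair_leB AB Aa; apply.
have red0 : red (H a v') != 0.
  by apply/eqP => /(residue_ker resO (OH _ Bv')).
have [c Oc redc] :
    exists2 c, O c & red c ^+ q = red (H a v) / red (H a v').
  (* The equation is [x ^+ q = t]: among the lower coefficients only the one of index 0 is
     nonzero. *)
  have [x] := solve_monicpoly
    (fun i => if i == 0%N then red (H a v) / red (H a v') else 0) q_gt0.
  rewrite -(prednK q_gt0) big_ord_recl expr0 mulr1 big1 ?addr0; last first.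
    by move=> i _; rewrite mul0r.
  move=> xq; have [c Oc cx] := residue_surj resO x.
  by exists c => //; rewrite cx -xq.
have Bw : B (v - c *: v').
  have subB := pair_subB AB.
  by apply: (submoduleB subO subB) => //; apply: (submoduleZ subB).
have ker : pi_ideal (H a (v - c *: v')).
  apply/(residue_ker resO); first exact: OH.
  rewrite -scaleNr HDr HZr rmorphN mulNr -mulrN.
  have Osc := s_int Oc; have ON := subringN subO (OH _ Bv').
  have redN x : O x -> red (- x) = - red x.
    move=> Ox; apply: (addrI (red x)).
    rewrite -(residueD resO) ?subrr //; last exact: subringN.
    apply/(residue_ker resO); first exact: subring0.
    exact: pi_ideal0.
  have [OHv OHv'] := (OH _ Bv, OH _ Bv').
  rewrite (residueD resO) ?(residueM resO) ?redN ?s_red //; last first.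
    exact: (subringM subO).
  by rewrite redc mulrN divfK ?subrr.
have nBa : ~ scale_set pi (hdual B) a.
  by move=> /scale_hdualP[_ Ba]; apply: nav'; apply: Ba.
(* The image under [tau] of [v - c *: v'] will lie in pi A^v, hence in [B], and that of [c *: v']
   lies in [Y]. *)
rewrite -(subrK (c *: v') v) tauD tauZ.
apply: (submoduleD (sum_submodule (pair_subB AB) subY)); last first.
  apply: sum_subr; first exact: pair_subB AB.
  by apply: (submoduleZ subY) => //; do 2!apply: s_int.
apply: (sum_subl subY); apply: (colength_sub (pair_lenA AB)).
apply/scale_hdualP; split; first exact: UtauB.
move=> y Ay; rewrite Htau; apply: pi_idealS.
have [x /scale_hdualP[_ Bx] [o Oo ->]] := colength1_gen subO (pair_lenB AB) Aa nBa Ay.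
by rewrite HDl HZl; apply: pi_idealD; [apply: Bx | apply: pi_idealM].
Qed.

(** For fixed [b], two uses of [Htau] give [H b (tau v) = s (s (H b v))]. So the vectors that pair
    with [b] into [pi O] form a tau-closed submodule, which contains the hull once it contains
    [A]. *)
Lemma hull_pi_ideal A LA b a :
  tau_hull A LA -> tau b = b -> (forall w, A w -> pi_ideal (H b w)) ->
  LA a -> pi_ideal (H b a).
Proof.
move=> hullA fixb Hb LAa.
apply: (hull_min hullA (Y := [set y | pi_ideal (H b y)]) _ Hb); last exact: rgen_incl.
  split=> /=.
  - by rewrite -(scale0r 0) HZr rmorph0 mul0r; apply: pi_ideal0.
  - by move=> v w Hv Hw; rewrite HDr; apply: pi_idealD.
  - by move=> o v Oo Hv; rewrite HZr; apply: pi_idealM => //; apply: s_int.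
by move=> v /= /pi_idealS/pi_idealS; rewrite -!Htau fixb.
Qed.

(** It suffices that [tau] maps [B] into B + T(Z). By [tau_sub_sum] this follows from a single
    vector of [B] whose image under [tau] lies in T(Z) but not in pi A^v. *)
Lemma hull_sub_sum A B Z LA LB LZ b a :
  dual_pair A B -> tau_hull A LA -> tau_hull B LB -> tau_hull Z LZ ->
  Z `<=` B -> LZ b -> LA a -> ~ pi_ideal (H b a) ->
  rgen O LB `<=` sum_set B (rgen O LZ).
Proof.
move=> AB hullA hullB hullZ ZB Zb LAa nba.
have subB := pair_subB AB.
have subY := rgen_submodule subO LZ.
have tauY := rgen_tau_closed (hull_fix hullZ).
have tauB v : B v -> U (tau v).
  move=> Bv; apply: (hull_in_U hullB); apply: (rgen_tau_closed (hull_fix hullB)).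
  exact: (hull_incl hullB).
suff tauS : forall v, B v -> sum_set B (rgen O LZ) (tau v).
  apply: (hull_min hullB); [exact: sum_submodule | exact: sum_subl subY |].
  move=> _ [x Bx [y Yy ->]]; rewrite tauD.
  apply: (submoduleD (sum_submodule subB subY)); first exact: tauS.
  by apply: (sum_subr subB); apply: tauY.
have [Yb fixb] : rgen O LZ b /\ tau b = b.
  by split; [apply: rgen_incl | apply: (hull_fix hullZ)].
(* If T(Z) lies in [B], the fixed vector [b] serves: inside pi A^v it would pair into [pi O] with
   all of [LA]. *)
have [YB|nYB] := pselect (rgen O LZ `<=` B).
  apply: (tau_sub_sum AB subY tauB (YB _ Yb)); rewrite fixb // => /scale_hdualP[_ Hb].
  by apply: nba; apply: (hull_pi_ideal hullA fixb Hb).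
(* Otherwise the intersection of T(Z) and [B] contains [Z] and is too small to be tau-closed. A
   vector whose image leaves [B] serves, as pi A^v lies in [B]. *)
have [v' [Yv' Bv'] nBv'] : exists2 v, rgen O LZ v /\ B v & ~ B (tau v).
  apply: contrapT => nv; apply: nYB.
  have /subset_trans : rgen O LZ `<=` rgen O LZ `&` B.
    apply: (hull_min hullZ).
    - split; first by split; [apply: submodule0 subY | apply: submodule0 subB].
      + by move=> v w [Yv Bv] [Yw Bw]; split;
          [apply: (submoduleD subY) | apply: (submoduleD subB)].
      + by move=> o v Oo [Yv Bv]; split;
          [apply: (submoduleZ subY) | apply: (submoduleZ subB)].
    - by move=> v Zv; split; [apply: (hull_incl hullZ) | apply: ZB].
    - move=> v [Yv Bv]; split; first exact: tauY.
      by apply: contrapT => ?; apply: nv; exists v.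
  by apply=> v [].
apply: (tau_sub_sum AB subY tauB Bv'); first exact: tauY.
by move/(colength_sub (pair_lenA AB)).
Qed.

(** The exponent [e] stands in for finite generation: pi^e Y < pi^e B + pi^(e+1) Y < B lowers it by
    one at each step. *)
Lemma nakayama (B Y : set V) e :
  is_submodule O B -> (forall v, Y v -> B (pi ^+ e *: v)) ->
  Y `<=` sum_set B (scale_set pi Y) -> Y `<=` B.
Proof.
move=> subB; elim: e => [|e IHe] YB Ysum; first by move=> v /YB; rewrite scale1r.
apply: IHe => // v /Ysum [x Bx [_ [y Yy <-] ->]].
rewrite scalerDr scalerA -exprSr; apply: (submoduleD subB); last exact: YB.
by apply: (submoduleZ subB) => //; apply: (subringX subO); apply: residue_pi resO.
Qed.

(* The chain is extended by B 0 = A 1 and A m.+1 = pi B m, which makes the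
   conditions at the indices 0 and m instances of the condition at i. *)
Lemma no_total_obstruction (m : nat) (A B LA LB : nat -> set V) e :
  (forall i, (1 <= i <= m)%N -> dual_pair (A i) (B i)) ->
  (forall i, (1 <= i <= m)%N -> scale_set pi (B i) `<=` A i) ->
  (forall i, (1 <= i <= m)%N -> A i.+1 `<=` A i) ->
  (forall i, (i < m)%N -> B i `<=` B i.+1) ->
  B 0%N = A 1%N -> LB 0%N = LA 1%N ->
  A m.+1 = scale_set pi (B m) -> LA m.+1 = scale_set pi (LB m) ->
  (forall i, (1 <= i <= m.+1)%N -> tau_hull (A i) (LA i)) ->
  (forall i, (i <= m)%N -> tau_hull (B i) (LB i)) ->
  (forall v, rgen O (LB m) v -> B m (pi ^+ e *: v)) -> (1 <= m)%N ->
  exists2 i, (i <= m)%N &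
    forall b a, LB i b -> LA i.+1 a -> pi_ideal (H b a).
Proof.
move=> AB piB chA chB B0 LB0 Am LAm hullA hullB fin_m m_gt0.
apply: contrapT => noI.
have obs i : (i <= m)%N ->
    exists b a, [/\ LB i b, LA i.+1 a & ~ pi_ideal (H b a)].
  move=> leim; apply: contrapT => nob; apply: noI; exists i => // b a Lb La.
  by apply: contrapT => nba; apply: nob; exists b, a.
have stepB i : (i < m)%N -> rgen O (LB i.+1) `<=` sum_set (B i.+1) (rgen O (LB i)).
  move=> ltim; have [b [a [Lb La nba]]] := obs i (ltnW ltim).
  apply: (hull_sub_sum _ _ _ _ _ Lb La nba).
  - exact: AB.
  - by apply: hullA; rewrite /= ltnS ltnW.
  - exact: hullB.
  - by apply: hullB; apply: ltnW.
  - exact: chB.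
have stepA i : (1 <= i <= m)%N -> rgen O (LA i) `<=` sum_set (A i) (rgen O (LA i.+1)).
  move=> im; have /andP[i_gt0 leim] := im; have [b [a [Lb La nba]]] := obs i leim.
  (* The failure at [i] is symmetric, since [H b a = H (tau b) a = s (H a b)], so [A] and [B] can be
     exchanged. *)
  have nab : ~ pi_ideal (H a b).
    by move/pi_idealS; rewrite -Htau (hull_fix (hullB i leim)).
  apply: (hull_sub_sum _ _ _ _ _ La Lb nab).
  - by apply: dual_pairC; apply: AB.
  - exact: hullB.
  - by apply: hullA; rewrite i_gt0 ltnW.
  - by apply: hullA.
  - exact: chA.
have subA i : (1 <= i <= m)%N -> is_submodule O (A i) by move/AB/pair_subA.
have subB i : (1 <= i <= m)%N -> is_submodule O (B i) by move/AB/pair_subB.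
have mm : (1 <= m <= m)%N by rewrite m_gt0 leqnn.
have m1 : (1 <= 1 <= m)%N by rewrite m_gt0.
have subY (L : set V) : is_submodule O (rgen O L) by apply: rgen_submodule.
have sub1 : is_submodule O (scale_set pi (B m)) by apply: scale_submodule; apply: subB.
have {}subA i : (1 <= i <= m.+1)%N -> is_submodule O (A i).
  case/andP=> i_gt0; rewrite leq_eqVlt => /orP[/eqP->|lti]; first by rewrite Am.
  by apply: subA; rewrite i_gt0.
have {}subB i : (i <= m)%N -> is_submodule O (B i).
  by case: i => [_|i lti]; [rewrite B0; apply: subA | apply: subB].
have chB0 i : (i <= m)%N -> B 0%N `<=` B i.
  elim: i => [|i IHi] lti; first exact: subset_refl.
  exact: subset_trans (IHi (ltnW lti)) (chB _ lti).
(* The inductions on the [A] side run downwards from the added index [m.+1], hence the index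
   [m.+1 - d]. *)
have chAm d : (d <= m)%N -> A m.+1 `<=` A (m.+1 - d)%N.
  elim: d => [|d IHd] ltd; first by rewrite subn0; apply: subset_refl.
  apply: (subset_trans (IHd (ltnW ltd))); rewrite subSS (subSn (ltnW ltd)); apply: chA.
  by rewrite subn_gt0 ltd leq_subr.
(* [stepB] telescopes: the smaller lattices are absorbed by [B i], and only T(B_0) = T(A_1) is
   left. *)
have YB i : (i <= m)%N -> rgen O (LB i) `<=` sum_set (B i) (rgen O (LB 0%N)).
  elim: i => [|i IHi] lti.
    by apply: sum_subr (subB _ lti).
  apply: (subset_trans (stepB i lti)).
  have subS := sum_submodule (subB _ lti) (subY (LB 0%N)).
  apply: (sum_sub subS); first by apply: sum_subl (subY _).
  apply: (subset_trans (IHi (ltnW lti))); apply: (sum_sub subS).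
    by apply: (subset_trans (chB _ lti)); apply: sum_subl (subY _).
  by apply: sum_subr (subB _ lti).
have YA d : (d <= m)%N ->
    rgen O (LA (m.+1 - d)%N) `<=` sum_set (A (m.+1 - d)%N) (rgen O (LA m.+1)).
  elim: d => [|d IHd] ltd.
    by rewrite subn0; apply: (sum_subr (subA _ _)); rewrite leqnn.
  have inA : (1 <= m.+1 - d.+1 <= m)%N by rewrite subSS subn_gt0 ltd leq_subr.
  have inA' : (1 <= m.+1 - d.+1 <= m.+1)%N by case/andP: inA => -> /= /leqW.
  have eqd : ((m.+1 - d.+1).+1 = m.+1 - d)%N by rewrite subSS (subSn (ltnW ltd)).
  have subS := sum_submodule (subA _ inA') (subY (LA m.+1)).
  apply: (subset_trans (stepA _ inA)).
  apply: (sum_sub subS); first by apply: sum_subl (subY _).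
  rewrite eqd; apply: (subset_trans (IHd (ltnW ltd))); apply: (sum_sub subS).
    by rewrite -eqd; apply: (subset_trans (chA _ inA)); apply: sum_subl (subY _).
  by apply: (sum_subr (subA _ inA')).
have YLA : rgen O (LA m.+1) `<=` scale_set pi (rgen O (LB m)).
  rewrite LAm; apply: rgen_sub; first exact: scale_submodule.
  by move=> _ [v Lv <-]; exists v => //; apply: rgen_incl.
(* T(B_m) < B_m + T(A_1) and T(A_1) < A_1 + pi T(B_m), where A_1 < B_m. *)
have Ym : rgen O (LB m) `<=` B m.
  apply: (nakayama (subB _ (leqnn m)) fin_m).
  have subS : is_submodule O (sum_set (B m) (scale_set pi (rgen O (LB m)))).
    by apply: sum_submodule; [apply: subB | apply: scale_submodule].
  apply: (subset_trans (YB m (leqnn m))); apply: (sum_sub subS).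
    by apply: (sum_subl (scale_submodule _ (subY _))).
  have := YA m (leqnn m); rewrite subSn // subnn -LB0 => /subset_trans; apply.
  apply: (sum_sub subS).
    rewrite -B0; apply: (subset_trans (chB0 m (leqnn m))).
    by apply: (sum_subl (scale_submodule _ (subY _))).
  by apply: (subset_trans YLA); apply: sum_subr (subB _ (leqnn m)).
(* Now pi T(B_m) < pi B_m = A_(m+1) < A_1, so T(A_1) is contained in A_1 as well. *)
have YA1 : rgen O (LB 0%N) `<=` B 0%N.
  have := YA m (leqnn m); rewrite subSn // subnn -LB0 -B0 => /subset_trans; apply.
  have sub0 := subB 0%N (leq0n m).
  apply: (sum_sub sub0) => //; apply: (subset_trans YLA) => _ [v /Ym Bv <-].
  have := chAm m (leqnn m); rewrite subSn // subnn -B0; apply.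
  by rewrite Am; exists v.
have {YB}YB i : (i <= m)%N -> rgen O (LB i) `<=` B i.
  move=> leim; apply: (subset_trans (YB i leim)); apply: (sum_sub (subB _ leim)) => //.
  by apply: (subset_trans YA1); apply: chB0.
(* From here on all lattices of the chain are tau-stable, since they contain
   their hulls. *)
have nonint d : (d <= m)%N ->
    exists v w, [/\ B (m - d)%N v, B (m - d)%N w & ~ O (H v w)].
  elim: d => [_|d IHd ltd].
    (* At the top [a] is [pi *: c] with [c] in [LB m]; dividing by [pi], the failure says that
       [H b c] is not integral. *)
    have [b [a [Lb]]] := obs m (leqnn m).
    rewrite LAm => -[c Lc <-] nba; rewrite subn0; exists b, c; split.
    - by apply: Ym; apply: rgen_incl.
    - by apply: Ym; apply: rgen_incl.
    - by move=> Obc; apply: nba; rewrite HZr s_pi; exists (H b c).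
  have [v [w []]] := IHd (ltnW ltd).
  have eqd : (m - d = (m - d.+1).+1)%N by rewrite subnSK.
  have lem : (m - d.+1 < m)%N by rewrite -eqd leq_subr.
  have lei := ltnW lem.
  rewrite eqd; move: (m - d.+1)%N lem lei => i {eqd ltd d IHd} lem lei Bv Bw nvw.
  have [b [a [Lb La nba]]] := obs i lei.
  have Bb : B i b by apply: YB => //; apply: rgen_incl.
  (* B_(i+1) = pi A_(i+1)^v + O b by simplicity, so integrality of [H b b] would make the form
     integral on all of B_(i+1). *)
  exists b, b; split => // Obb; apply: nvw.
  have pAB : dual_pair (A i.+1) (B i.+1) by apply: AB.
  have piBA : scale_set pi (B i.+1) `<=` A i.+1 by apply: piB.
  have hullAi : tau_hull (A i.+1) (LA i.+1) by apply: hullA; rewrite /= ltnS ltnW.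
  have hullBi := hullB _ lem.
  have hullBi0 := hullB _ lei.
  have nAb : ~ scale_set pi (hdual (A i.+1)) b.
    move=> /scale_hdualP[_ Hb]; apply: nba.
    exact: (hull_pi_ideal hullAi (hull_fix hullBi0 Lb) Hb).
  have intl x y : scale_set pi (hdual (A i.+1)) x -> B i.+1 y -> O (H x y).
    move=> /scale_hdualP[_ Hx] By; apply: subring_pi_ideal.
    by rewrite -[X in X * _]s_pi -HZr; apply: Hx; apply: piBA; exists y.
  (* To exchange the arguments, [x] is expanded in fixed vectors [u], for which
     [H u y = H (tau u) y = s (H y u)]. *)
  have intr x y : B i.+1 x -> scale_set pi (hdual (A i.+1)) y -> O (H x y).
    move=> Bx Ay.
    apply: (rgen_sub (M := [set u | O (H u y)]) _ _ (hull_incl hullBi Bx)).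
      split=> /=.
      - by rewrite -(scale0r 0) HZl mul0r; apply: subring0.
      - by move=> u t Hu Ht; rewrite HDl; apply: subringD.
      - by move=> o u Oo Hu; rewrite HZl; apply: (subringM subO).
    move=> u Lu /=; rewrite -(hull_fix hullBi Lu) Htau; apply: s_int.
    by apply: intl => //; apply: YB => //; apply: rgen_incl.
  have Bb' := chB _ lem _ Bb.
  have [x Ax [c Oc ->]] := colength1_gen subO (pair_lenA pAB) Bb' nAb Bv.
  have [y Ay [c' Oc' eqw]] := colength1_gen subO (pair_lenA pAB) Bb' nAb Bw.
  rewrite HDl HZl; apply: (subringD subO); first exact: intl.
  apply: (subringM subO) => //; rewrite eqw HDr HZr; apply: (subringD subO).
    exact: intr.
  by apply: (subringM subO) => //; apply: s_int.
have [v [w []]] := nonint m (leqnn m); rewrite subnn => Av Aw; apply.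
have [_] := pair_leA (AB 1%N m1) (chB0 1%N m_gt0 _ Av); apply.
by rewrite -B0.
Qed.

End SemilinearChain.

(** * Descent of Witt vectors from [k] to the field with q^2 elements *)

Section WittDescent.
Local Open Scope classical_set_scope.
Variables (p : nat) (F : padicField p) (E : unramifiedQuadratic F).
Variables (Fq2 : finFieldType) (e2 : {rmorphism resF F -> Fq2}).
Hypothesis card_Fq2 : (#|Fq2| = #|resF F| ^ 2)%N.
Variables (k : fieldType) (f : {rmorphism Fq2 -> k}) (ek : resF F -> k).
Variables (W : wittVectors e2) (Wk : wittVectors ek) (j : wittMap f W Wk).
Variables (phi0 : {rmorphism E -> W}) (phi0_bij : bijective phi0).
Hypothesis phi0_F : forall a : F, phi0 a%:A = wstr W a.

Lemma wittMap_pi : j (wpi W) = wpi Wk. Proof. exact: wmap_str. Qed.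

Lemma wfrob_pi : wfrob Wk (wpi Wk) = wpi Wk. Proof. exact: wfrob_str. Qed.

(* W = E is quadratic over F and the Frobenius fixes F. *)
Lemma wfrob_involutive (w : W) : wfrob W (wfrob W w) = w.
Proof.
case: phi0_bij => psi _ psiK; rewrite -(psiK w); move: (psi w) => x {w}.
have fixF (a : F) : wfrob W (phi0 a%:A) = phi0 a%:A by rewrite phi0_F wfrob_str.
have [x1|x1] := boolP (x \in 1%VS).
  by have /vlineP[a ->] := x1; rewrite !fixF.
have bx : basis_of (fullv : {vspace E}) [:: x; 1].
  rewrite basisEfree subvf qE_dim leqnn !andbT free_cons span_seq1.
  by rewrite x1 seq1_free oner_eq0.
have : x ^+ 2 \in <<[:: x; 1%R]>>%VS by rewrite (span_basis bx) memvf.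
rewrite span_cons span_seq1 => /memv_addP[_ /vlineP[b ->] [_ /vlineP[a ->] eqx]].
have {eqx} eqw : phi0 x ^+ 2 = phi0 b%:A * phi0 x + phi0 a%:A.
  by rewrite -rmorphM mulr_algl -rmorphD -rmorphXn eqx.
have eqs : wfrob W (phi0 x) ^+ 2 = phi0 b%:A * wfrob W (phi0 x) + phi0 a%:A.
  by rewrite -rmorphXn eqw rmorphD rmorphM !fixF.
set w := phi0 x in eqw eqs *; set t := wfrob W w in eqs *.
(* [t] and [w] are roots of the same quadratic polynomial over [F], so [t] is [w] or its conjugate
   [phi0 b%:A - w]; in both cases a second Frobenius returns to [w]. *)
have : (t - w) * (t + w - phi0 b%:A) = 0.
  have -> : (t - w) * (t + w - phi0 b%:A) =
    (t ^+ 2 - phi0 b%:A * t) - (w ^+ 2 - phi0 b%:A * w) by ring.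
  by rewrite eqs eqw; ring.
move/eqP; rewrite mulf_eq0 !subr_eq0 => /orP[/eqP tw|/eqP tw].
  by rewrite tw -/t tw.
have -> : t = phi0 b%:A - w by rewrite -tw addrK.
by rewrite rmorphB fixF -/t -tw addrC addKr.
Qed.

(** As [f] is injective, an integral element of [W] divisible by [pi] in [Wk] is so in [W]. The
    powers of [pi] that clear the denominator of [w] are thus removed one at a time. *)
Lemma wint_wittMap (w : W) : wint Wk (j w) -> wint W w.
Proof.
have strW := wint_strict W; have strk := wint_strict Wk.
have [resW resk] := (strict_residue strW, strict_residue strk).
have piW : wpi W != 0 := strict_pi strW.
move=> jw; have [i] := strict_frac strW w; rewrite -/(wpi W).
elim: i => [|i IHi]; first by rewrite mul1r.
move=> Ow; apply: IHi.
have /(residue_ker resW Ow) [y Oy] : wred (wpi W ^+ i.+1 * w) = 0.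
  apply: (fmorph_inj f); rewrite -(wmap_red j) // rmorph0.
  apply/(residue_ker resk); first exact: wmap_int.
  rewrite rmorphM rmorphXn wittMap_pi exprS -mulrA.
  exists (wpi Wk ^+ i * j w) => //; apply: (subringM (residue_subring resk)) => //.
  by apply: subringX; [apply: residue_subring resk | apply: residue_pi resk].
by rewrite exprS -mulrA => /(mulfI piW) ->.
Qed.

(** With Q the order of [Fq2], the polynomial X^Q - X is the product of all X - c, and remains so
    over [k]. *)
Lemma finField_root (a : k) : a ^+ #|Fq2| = a -> exists c, f c = a.
Proof.
move=> aq; have := congr1 (fun P => (map_poly f P).[a]) (finField_genPoly Fq2).
rewrite rmorphB rmorphXn /= map_polyX !hornerE aq subrr rmorph_prod horner_prod.
move/esym/eqP/prodf_eq0 => [c _]; rewrite rmorphB /= map_polyX map_polyC /=.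
rewrite hornerXsubC subr_eq0 => /eqP ->.
by exists c.
Qed.

(** A fixed integral element has its residue in [Fq2], hence a first digit from [W], and the
    remainder is fixed again; completeness of [W] sums the digits. *)
Lemma wfrob2_fixed (x : Wk) : wfrob Wk (wfrob Wk x) = x -> exists w, x = j w.
Proof.
have strW := wint_strict W; have strk := wint_strict Wk.
have [resW resk] := (strict_residue strW, strict_residue strk).
have [subW subk] := (residue_subring resW, residue_subring resk).
have piW : wpi W != 0 := strict_pi strW.
have pik : wpi Wk != 0 := strict_pi strk.
move=> fix_x; have [i Ox] := strict_frac strk x; rewrite -/(wpi Wk) in Ox.
suff [w eqw] : exists w, wpi Wk ^+ i * x = j w.
  exists (w / wpi W ^+ i); rewrite fmorph_div rmorphXn wittMap_pi -eqw mulrC mulKf //.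
  by rewrite expf_neq0.
have {fix_x} : wfrob Wk (wfrob Wk (wpi Wk ^+ i * x)) = wpi Wk ^+ i * x.
  by rewrite !rmorphM !rmorphXn !wfrob_pi fix_x.
move: (wpi Wk ^+ i * x) Ox => {i}{}x Ox fix_x.
have lift (y : Wk) : wint Wk y -> wfrob Wk (wfrob Wk y) = y ->
    exists2 w, wint W w & exists2 z, wint Wk z & y = j w + wpi Wk * z.
  move=> Oy fix_y; have [c fc] : exists c, f c = wred y.
    apply: finField_root; rewrite -[RHS](congr1 _ fix_y) card_Fq2 expnS expn1 exprM.
    by rewrite !wfrob_red //; apply: wfrob_int.
  have [w Ow wc] := residue_surj resW c; exists w => //.
  have Ojw := wmap_int j Ow.
  have /(residue_ker resk) [|z Oz eqz] : wred (y - j w) = 0.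
  - have := residueD resk (subringB subk Oy Ojw) Ojw.
    rewrite subrK (wmap_red j) // wc fc -{1}[wred y]add0r => /addIr //.
  - exact: subringB.
  - by exists z => //; rewrite -eqz addrC subrK.
have [step stepP] : exists step : nat -> W -> W, forall i w,
    wint W w -> wint Wk ((x - j w) / wpi Wk ^+ i) ->
    [/\ wint W (step i w), wint W ((step i w - w) / wpi W ^+ i) &
        wint Wk ((x - j (step i w)) / wpi Wk ^+ i.+1)].
  have ex (iw : nat * W) : exists w', 
    wint W iw.2 -> wint Wk ((x - j iw.2) / wpi Wk ^+ iw.1) ->
    [/\ wint W w', wint W ((w' - iw.2) / wpi W ^+ iw.1) &
        wint Wk ((x - j w') / wpi Wk ^+ iw.1.+1)].
    case: iw => i w /=.
    (* [choice] needs a total function: the value is 0 where the hypotheses fail. *)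
    have [[Ow Oxw]|no] := pselect (wint W w /\ wint Wk ((x - j w) / wpi Wk ^+ i));
      last by exists 0 => Ow Oxw; case: no.
    (* The next digit is that of the scaled remainder, which is fixed because [j w] is. *)
    have [|v Ov [z Oz eqz]] := lift _ Oxw.
      rewrite !fmorph_div !rmorphB !rmorphXn /= !wfrob_pi fix_x.
      by rewrite -!wmap_frob wfrob_involutive.
    exists (w + wpi W ^+ i * v) => _ _; split.
    - apply: subringD => //; apply: (subringM subW) => //.
      by apply: subringX => //; apply: residue_pi resW.
    - by rewrite addrC addKr mulrC mulKf // expf_neq0.
    - rewrite rmorphD rmorphM rmorphXn wittMap_pi.
      have -> : x - (j w + wpi Wk ^+ i * j v) = wpi Wk ^+ i.+1 * z.
        rewrite opprD addrA -[x - j w](divfK (expf_neq0 i pik)) eqz.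
        by rewrite exprS; ring.
      by rewrite mulrC mulKf // expf_neq0.
  have [step' stepP] := choice ex.
  by exists (fun i w => step' (i, w)) => i w; apply: (stepP (i, w)).
pose u := fix u i := if i is i'.+1 then step i' (u i') else 0.
have uP i : wint W (u i) /\ wint Wk ((x - j (u i)) / wpi Wk ^+ i).
  elim: i => [|i [Ou Oxu]] /=.
    by rewrite rmorph0 subr0 expr0 divr1; split=> //; apply: subring0.
  by have [] := stepP i _ Ou Oxu.
have [i|i|l Ol lP] := strict_complete strW (u := u).
- by have [] := uP i.
- by have [Ou Oxu] := uP i; have [] := stepP i _ Ou Oxu.
exists l; apply/eqP; rewrite -subr_eq0; apply/eqP.
apply: (strict_separated strk) => i; rewrite -/(wpi Wk).
have -> : (x - j l) / wpi Wk ^+ i =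
    (x - j (u i)) / wpi Wk ^+ i - j ((l - u i) / wpi W ^+ i).
  rewrite fmorph_div rmorphB rmorphXn wittMap_pi -mulrBl.
  by congr (_ / _); ring.
by apply: (subringB subk); [have [] := uP i | apply: wmap_int; apply: lP].
Qed.

End WittDescent.

(** * The hermitian form on [N], and descent of lattices from [Ck] to [C] *)

Section HermitianSpace.
Local Open Scope classical_set_scope.
Variables (p : nat) (F : padicField p) (E : unramifiedQuadratic F).
Variables (Fq2 : finFieldType) (e2 : {rmorphism resF F -> Fq2}).
Hypothesis card_Fq2 : (#|Fq2| = #|resF F| ^ 2)%N.
Variables (k : fieldType) (f : {rmorphism Fq2 -> k}) (ek : resF F -> k).
Variables (W : wittVectors e2) (Wk : wittVectors ek) (j : wittMap f W Wk).
Variables (phi0 : {rmorphism E -> W}) (phi0_bij : bijective phi0).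
Hypothesis phi0_F : forall a : F, phi0 a%:A = wstr W a.
Variables (delta : W) (delta_frob : wfrob W delta = - delta).
Variables (n h1 : nat) (X : framing phi0 n h1) (N : framingBC X j).

Let pi := wpi Wk.
Let O : set Wk := wint Wk.
Let strk : is_strict_ring O pi (@wred _ _ _ _ Wk) := wint_strict Wk.
Let pi_neq0 : pi != 0 := strict_pi strk.
Let subO : is_subring O := residue_subring (strict_residue strk).

(** [N] is spanned by the image of [X]; identities of the extended structure are thereby reduced to
    those of [X]. *)
Lemma framingBC_ind (P : N -> Prop) :
  (forall v w, P v -> P w -> P (v + w)) -> (forall a v, P v -> P (a *: v)) ->
  (forall v, P (bc N v)) -> forall v, P v.
Proof.
move=> PD PZ Pbc v; have P0 : P 0 by rewrite -(scale0r (bc N 0)); apply: PZ.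
have bN := bc_basis N (vbasisP (fullv : {vspace X})).
have vb : v \in <<map_tuple (bc N) (vbasis (fullv : {vspace X}))>>%VS.
  by rewrite (span_basis bN) memvf.
rewrite (coord_span vb); apply: big_ind => // i _; apply: PZ.
by rewrite (nth_map 0) // size_tuple.
Qed.

Lemma bpairDl (v w u : N) : bpair (v + w) u = bpair v u + bpair w u :> Wk.
Proof. by have := bpair_linl 1 v w u; rewrite scale1r mul1r. Qed.

Lemma bpairDr (v w u : N) : bpair u (v + w) = bpair u v + bpair u w :> Wk.
Proof. by have := bpair_linr 1 v w u; rewrite scale1r mul1r. Qed.

Lemma bpair0l (u : N) : bpair 0 u = 0 :> Wk.
Proof. by apply: (addIr (bpair (0 : N) u)); rewrite -bpairDl !add0r. Qed.

Lemma bpair0r (u : N) : bpair u 0 = 0 :> Wk.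
Proof. by apply: (addIr (bpair u (0 : N))); rewrite -bpairDr !add0r. Qed.

Lemma bpairZl a (v u : N) : bpair (a *: v) u = a * bpair v u :> Wk.
Proof. by have := bpair_linl a v 0 u; rewrite bpair0l !addr0. Qed.

Lemma bpairZr a (v u : N) : bpair u (a *: v) = a * bpair u v :> Wk.
Proof. by have := bpair_linr a v 0 u; rewrite bpair0r !addr0. Qed.

Lemma dpairC (v w : X) : dpair v w = - dpair w v.
Proof.
have D a b c : dpair (a + b : X) c = dpair a c + dpair b c.
  by have := dpair_linl 1 a b c; rewrite scale1r mul1r.
have D' a b c : dpair c (a + b : X) = dpair c a + dpair c b.
  by have := dpair_linr 1 a b c; rewrite scale1r mul1r.
have := dpair_alt (v + w); rewrite D !D' !dpair_alt addr0 add0r => /eqP.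
by rewrite addr_eq0 => /eqP.
Qed.

Lemma bpairC (v w : N) : bpair v w = - bpair w v.
Proof.
elim/framingBC_ind: v w => [v v' IHv IHv'|a v IHv|v] w.
- by rewrite bpairDl bpairDr IHv IHv' opprD.
- by rewrite bpairZl bpairZr IHv mulrN.
elim/framingBC_ind: w => [w w' IHw IHw'|a w IHw|w].
- by rewrite bpairDl bpairDr IHw IHw' opprD.
- by rewrite bpairZl bpairZr IHw mulrN.
by rewrite !bpair_bc dpairC rmorphN.
Qed.

(** On [X] this is <Fv, Fw> = <v, VFw>^sigma with VF = pi; both sides are sigma-linear in each
    variable. *)
Lemma bpair_FF (v w : N) : bpair (bF v) (bF w) = pi * wfrob Wk (bpair v w).
Proof.
elim/framingBC_ind: v w => [v v' IHv IHv'|a v IHv|v] w.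
- by rewrite bFD !bpairDl IHv IHv' rmorphD mulrDr.
- by rewrite bFZ !bpairZl IHv rmorphM mulrCA.
elim/framingBC_ind: w => [w w' IHw IHw'|a w IHw|w].
- by rewrite bFD !bpairDr IHw IHw' rmorphD mulrDr.
- by rewrite bFZ !bpairZr IHw rmorphM mulrCA.
have Z a (u u' : X) : dpair u (a *: u') = a * dpair u u'.
  have u0 : dpair u 0 = 0.
    apply: (addIr (dpair u 0)).
    by have := dpair_linr 1 0 0 u; rewrite scale1r mul1r !add0r.
  by have := dpair_linr a u' 0 u; rewrite u0 !addr0.
rewrite !bF_bc !bpair_bc dpair_FV dVF Z rmorphM wfrob_str rmorphM wittMap_pi.
by rewrite wmap_frob.
Qed.

Lemma tauE (v : N) : tau v = pi^-1 *: bF (bF v).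
Proof.
by rewrite /tau /invV bFZ !scalerA fmorphV wfrob_pi divff // mul1r.
Qed.

Lemma tauD (v w : N) : tau (v + w) = tau v + tau w.
Proof. by rewrite !tauE !bFD scalerDr. Qed.

Lemma tauZ a (v : N) : tau (a *: v) = wfrob Wk (wfrob Wk a) *: tau v.
Proof. by rewrite !tauE !bFZ !scalerA mulrC. Qed.

Lemma hermDl (v w u : N) : herm delta (v + w) u = herm delta v u + herm delta w u.
Proof. by rewrite /herm bpairDl mulrDr. Qed.

Lemma hermZl a (v u : N) : herm delta (a *: v) u = a * herm delta v u.
Proof. by rewrite /herm bpairZl mulrCA. Qed.

Lemma hermDr (v w u : N) : herm delta u (v + w) = herm delta u v + herm delta u w.
Proof. by rewrite /herm bFD bpairDr mulrDr. Qed.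

Lemma hermZr a (v u : N) : herm delta u (a *: v) = wfrob Wk a * herm delta u v.
Proof. by rewrite /herm bFZ bpairZr mulrCA. Qed.

(** By [bpair_FF], <tau v, Fw> = <Fv, w>^sigma, and the sign from exchanging the arguments cancels
    that of [delta_frob]. On [C] it is hermitian symmetry. *)
Lemma herm_tau (v w : N) : herm delta (tau v) w = wfrob Wk (herm delta w v).
Proof.
rewrite /herm tauE bpairZl bpair_FF mulKf // rmorphM -wmap_frob delta_frob.
by rewrite bpairC rmorphN mulrN rmorphN mulNr.
Qed.

Lemma Ck_submodule : is_submodule setT (Ck (N := N)).
Proof.
have bE0 x : bE x (0 : N) = 0.
  by apply: (addIr (bE x (0 : N))); rewrite -bED !add0r.
split=> [x|v w Cv Cw x|a v _ Cv x].
- by rewrite bE0 scaler0.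
- by rewrite bED Cv Cw scalerDr.
- by rewrite bEZ Cv !scalerA mulrC.
Qed.

Lemma C_scale c (v : N) : wfrob Wk c = c -> C v -> C (c *: v).
Proof.
move=> fix_c [Cv tv]; split; first exact: (submoduleZ Ck_submodule).
by rewrite tauZ !fix_c tv.
Qed.

(* Linear independence over sigma^2-fixed scalars of tau-fixed vectors
   extends to all scalars, by applying tau to a shortest relation. *)
Lemma C_free (b : seq N) :
  (forall v, v \in b -> C v) ->
  (forall a : nat -> Wk, (forall i, range j (a i)) ->
     \sum_(i < size b) a i *: b`_i = 0 -> forall i, (i < size b)%N -> a i = 0) ->
  free b.
Proof.
elim/last_ind: b => [|b v IHb] Cb indb; first by rewrite nil_free.
have freeb : free b.
  apply: IHb => [w bw|a ja sum0 i lti].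
    by apply: Cb; rewrite mem_rcons inE bw orbT.
  (* Truncation gives the last vector [v] the coefficient 0. *)
  pose a' i := if (i < size b)%N then a i else 0.
  suff: a' i = 0 by rewrite /a' lti.
  apply: indb.
  - move=> l; rewrite /a'; case: ifP => // _; exists 0 => //; exact: rmorph0.
  - rewrite size_rcons big_ord_recr /= /a' ltnn scale0r addr0 -[RHS]sum0.
    by apply: eq_bigr => l _; rewrite ltn_ord nth_rcons ltn_ord.
  - by rewrite size_rcons ltnW.
have -> : free (rcons b v) = free (v :: b) by apply: perm_free; rewrite perm_rcons.
rewrite free_cons freeb andbT; apply/negP => bv.
have eqv : v = \sum_(i < size b) coord (in_tuple b) i v *: b`_i.
  exact: (coord_span (X := in_tuple b) bv).
have fixc i : wfrob Wk (wfrob Wk (coord (in_tuple b) i v)) = coord (in_tuple b) i v.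
  have [_ tv] : C v by apply: Cb; rewrite mem_rcons inE eqxx.
  have tau_sum (c : 'I_(size b) -> Wk) (r : seq 'I_(size b)) :
      tau (\sum_(i <- r) c i *: b`_i) = \sum_(i <- r) wfrob Wk (wfrob Wk (c i)) *: b`_i.
    elim: r => [|l r IHr].
      by rewrite !big_nil; apply: (addIr (tau (0 : N))); rewrite -tauD !add0r.
    rewrite !big_cons tauD tauZ IHr; congr (_ *: _ + _).
    by have [] // := Cb b`_l; rewrite mem_rcons inE mem_nth ?orbT.
  have eqv2 : v = \sum_(i < size b) wfrob Wk (wfrob Wk (coord (in_tuple b) i v)) *: b`_i.
    by rewrite -[in LHS]tv {1}eqv tau_sum.
  by rewrite {2}eqv2 coord_sum_free.
have jc i : range j (coord (in_tuple b) i v).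
  have [w ->] := wfrob2_fixed card_Fq2 j phi0_bij phi0_F (fixc i); by exists w.
(* The default -1 is the coefficient of [v], at index [size b], in the forbidden relation. *)
pose a i := if insub i is Some l then coord (in_tuple b) l v else -1.
have /(_ _ _ (size b)) := indb a; rewrite size_rcons ltnSn.
suff [ja sum0] : (forall i, range j (a i)) /\
    \sum_(i < (size b).+1) a i *: (rcons b v)`_i = 0.
  move=> /(_ ja sum0 isT) /eqP; rewrite /a insubF ?ltnn //.
  by rewrite oppr_eq0 oner_eq0.
split=> [i|].
  rewrite /a; case: insubP => [l _ _|_]; first exact: jc.
  by exists (-1) => //; rewrite rmorphN rmorph1.
rewrite big_ord_recr /= nth_rcons ltnn eqxx /a insubF ?ltnn // scaleN1r.
apply/eqP; rewrite subr_eq0; apply/eqP; rewrite [RHS]eqv; apply: eq_bigr => i _.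
by rewrite /= nth_rcons ltn_ord valK.
Qed.

Lemma range_wint_subring : is_subring (j @` wint W).
Proof.
have subW := residue_subring (strict_residue (wint_strict W)).
split.
- by exists 1; [apply: subring1 | rewrite rmorph1].
- by move=> _ _ [x Ox <-] [y Oy <-]; exists (x - y); [apply: subringB | rewrite rmorphB].
- by move=> _ _ [x Ox <-] [y Oy <-]; exists (x * y); [apply: subringM | rewrite rmorphM].
Qed.

(** A basis of [C] stays free over [Wk], so the integral coefficients of [v] agree with those coming
    from [W], and integrality descends along [j]. *)
Lemma latticeC_descent (L : set N) v : latticeC L -> rgen O L v -> C v -> L v.
Proof.
move=> [b [Cb indb] ->] Lv Cv.
have subOR := range_wint_subring.
have subFR : is_subring (range j).
  split.
  - by exists 1 => //; rewrite rmorph1.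
  - by move=> _ _ [x _ <-] [y _ <-]; exists (x - y) => //; rewrite rmorphB.
  - by move=> _ _ [x _ <-] [y _ <-]; exists (x * y) => //; rewrite rmorphM.
have bC w : w \in b -> C w by rewrite Cb; apply: rspan_mem.
have freeb := C_free bC indb.
have [o Oo eqo] : rspan O b v.
  apply: rgen_sub Lv; first exact: rspan_submodule.
  move=> _ [a ORa ->]; exists a => // i.
  by have [w Ow <-] := ORa i; apply: wmap_int.
move: Cv; rewrite Cb => -[a ja eqa].
pose c i := if (i < size b)%N then a i else 0.
exists c => [i|]; last by rewrite eqa; apply: eq_bigr => i _; rewrite /c ltn_ord.
rewrite /c; case: ifP => [lti|_]; last by apply: subring0.
have eqi : a i = o i.
  have := coord_sum_free (fun l : 'I_(size b) => a l) (Ordinal lti) (X := in_tuple b) freeb.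
  rewrite -eqa eqo.
  have := coord_sum_free (fun l : 'I_(size b) => o l) (Ordinal lti) (X := in_tuple b) freeb.
  by move=> -> ->.
have [w _ eqw] := ja i; exists w => //; apply: (wint_wittMap (j := j)).
by rewrite eqw eqi; apply: Oo.
Qed.

Lemma latticeCk_submodule (A : set N) : latticeCk A -> is_submodule O A /\ A `<=` Ck (N := N).
Proof.
move=> [b [Cb _] ->]; split; first exact: rspan_submodule.
by rewrite Cb => _ [a _ ->]; exists a.
Qed.

Lemma latticeC_sub (L : set N) : latticeC L -> L `<=` C (N := N).
Proof.
move=> [b [-> _] ->] _ [a ORa ->]; exists a => // i.
by have [w _ <-] := ORa i; exists w.
Qed.

Lemma tau0 : tau (0 : N) = 0.
Proof. by rewrite -[X in tau X](scale0r 0) tauZ !rmorph0 scale0r. Qed.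

Lemma Lambda_hull (A L : set N) :
  latticeCk A -> is_Lambda A L -> tau_hull O (tau (N := N)) (Ck (N := N)) A L.
Proof.
move=> /latticeCk_submodule[subA _] [latL [s0 Ls0]]; split.
- by move=> v /(latticeC_sub latL) [].
- by move=> v /(latticeC_sub latL) [].
(* The successor ensures that the summand of index 0, which is [A] itself, is present. *)
- move=> v Av; rewrite (Ls0 s0.+1 (leqnSn _)).
  exists (fun i => if i is 0%N then v else 0).
    case=> [|i] _; first by exists v.
    exists 0; first exact: submodule0 subA.
    by elim: (i.+1) => //= d ->; rewrite tau0.
  by rewrite big_ord_recl big1 ?addr0.
- move=> Y subY AY tauY; rewrite (Ls0 s0 (leqnn _)) => _ [u Au ->].
  apply: (submodule_sum subY) => i lti; have [v Av <-] := Au i lti.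
  by elim: i {Au lti u} => [|i IHi]; [apply: AY | apply: tauY].
Qed.

Lemma common_exponent (r : nat) (P : nat -> nat -> Prop) :
  (forall i e, P i e -> P i e.+1) ->
  (forall i, (i < r)%N -> exists e, P i e) ->
  exists e, forall i, (i < r)%N -> P i e.
Proof.
move=> PS; have PD i e d : P i e -> P i (e + d)%N.
  by move=> Pie; elim: d => [|d IHd]; rewrite ?addn0 ?addnS //; apply: PS.
elim: r => [|r IHr] exP; first by exists 0%N.
have [e1 P1] := IHr (fun i lti => exP i (ltnW lti)).
have [e2' P2] := exP r (leqnn _).
exists (e1 + e2')%N => i; rewrite ltnS leq_eqVlt => /orP[/eqP->|/P1]; last exact: PD.
by rewrite addnC; apply: PD.
Qed.

Lemma latticeCk_absorb (A : set N) v :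
  latticeCk A -> Ck v -> exists e, A (pi ^+ e *: v).
Proof.
move=> [b [Cb _] ->]; rewrite Cb => -[a _ ->].
have [e Oe] : exists e, forall i, (i < size b)%N -> O (pi ^+ e * a i).
  apply: common_exponent => [i e Oe|i _]; last exact: strict_frac strk (a i).
  rewrite exprS -mulrA; apply: (subringM subO) => //.
  exact: residue_pi (strict_residue strk).
exists e, (fun i => if (i < size b)%N then pi ^+ e * a i else 0).
  by move=> i; case: ifP => [/Oe //|_]; apply: subring0.
by rewrite scaler_sumr; apply: eq_bigr => i _; rewrite ltn_ord scalerA.
Qed.

(** A common exponent for the finitely many basis vectors works; it supplies the bound in the
    Nakayama argument. *)
Lemma latticeC_absorb (A L : set N) :
  latticeCk A -> latticeC L -> exists e, forall v, rgen O L v -> A (pi ^+ e *: v).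
Proof.
move=> latA latL; have [subA _] := latticeCk_submodule latA.
have LC := latticeC_sub latL; have [b _ eqL] := latL.
have subOR : is_subring (j @` wint W).
  exact: range_wint_subring.
have [e Ae] : exists e, forall i, (i < size b)%N -> A (pi ^+ e *: b`_i).
  apply: common_exponent => [i e Ae|i lti].
    rewrite exprS -scalerA; apply: (submoduleZ subA) => //.
    exact: residue_pi (strict_residue strk).
  apply: latticeCk_absorb => //.
  by have [] // := LC b`_i; rewrite eqL; apply: rspan_mem => //; apply: mem_nth.
exists e; apply: (rgen_sub (M := [set v | A (pi ^+ e *: v)])).
  split=> /= [|v w Av Aw|a v Oa Av].
  - by rewrite scaler0; apply: submodule0 subA.
  - by rewrite scalerDr; apply: (submoduleD subA).
  - by rewrite scalerA mulrC -scalerA; apply: (submoduleZ subA).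
move=> v /=; rewrite eqL => -[a ORa ->]; rewrite scaler_sumr.
apply: (submodule_sum (u := fun i => pi ^+ e *: (a i *: b`_i)) subA) => i lti.
rewrite scalerA mulrC -scalerA; apply: (submoduleZ subA); last exact: Ae.
by have [w Ow <-] := ORa i; apply: wmap_int.
Qed.

(** A vector of the dual of [L] pairs integrally with [M], so its multiple by [pi ^+ i.+1] lies in
    [M] and descends to [L]. The other inclusion is the divisibility of the form on [L] by
    [pi ^+ i]. *)
Lemma vertexI (i : nat) (M L : set N) :
  latticeC L -> M `<=` rgen O L ->
  (forall v, Ck v -> (forall w, M w -> O (herm delta v w)) -> M (pi ^+ i.+1 *: v)) ->
  (forall b a, L b -> L a -> O (pi ^- i * herm delta b a)) ->
  vertex delta i%:Z L.
Proof.
move=> latL ML dualM intL; have LC := latticeC_sub latL; split=> //.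
- have -> : wpi Wk ^ (i%:Z + 1) = pi ^+ i.+1 by rewrite -addn1.
  move=> _ [v [Cv Lv] <-]; apply: latticeC_descent => //; last first.
    by apply: C_scale => //; rewrite rmorphXn /= wfrob_pi.
  apply: (ML); apply: dualM => [|w /ML]; first by case: Cv.
  apply: (rgen_sub (M := [set w | O (herm delta v w)])) => //.
  split=> /= [|a b Oa Ob|a b Oa Ob].
  - by rewrite -(scale0r 0) hermZr rmorph0 mul0r; apply: subring0.
  - by rewrite hermDr; apply: subringD.
  - by rewrite hermZr; apply: (subringM subO) => //; apply: wfrob_int.
- move=> v Lv; exists (pi ^- i *: v); last first.
    by rewrite scalerA -exprnP divff ?scale1r // expf_neq0.
  split; last by move=> w Lw; rewrite hermZl; apply: intL.
  by apply: C_scale; [rewrite fmorphV rmorphXn /= wfrob_pi | apply: LC].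
Qed.

End HermitianSpace.

(** * Translation of the three kinds of indices into membership in [I] *)

Theorem lemma2p30
  (p : nat) (p_prime : prime p) (p_odd : odd p)
  (F : padicField p) (E : unramifiedQuadratic F)
  (n m : nat) (n_pos : (1 <= n)%N) (m_pos : (1 <= m)%N)
  (h : nat -> nat)
  (h_incr : forall i, (1 <= i < m)%N -> (h i < h i.+1)%N)
  (h_le : forall i, (1 <= i <= m)%N -> (h i <= n)%N)
  (h_parity : forall i, (1 <= i <= m)%N -> odd (h i) = odd (h 1%N))
  (Fq2 : finFieldType) (card_Fq2 : (#|Fq2| = #|resF F| ^ 2)%N)
  (e2 : {rmorphism resF F -> Fq2})
  (kappa : closedFieldType) (ekappa : {rmorphism Fq2 -> kappa})
  (kappa_alg : forall x : kappa, algebraicOver ekappa x)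
  (k : closedFieldType) (ek : {rmorphism kappa -> k})
  (W : wittVectors e2) (Wk : wittVectors (ek \o (ekappa \o e2)))
  (j : wittMap (ek \o ekappa) W Wk)
  (phi0 : {rmorphism E -> W}) (phi0_bij : bijective phi0)
  (phi0_F : forall a : F, phi0 a%:A = wstr W a)
  (delta : W) (delta_int : wint W delta) (delta_unit : wint W delta^-1)
  (delta_frob : wfrob W delta = - delta)
  (X : framing phi0 n (h 1%N)) (N : framingBC X j)
  (A B : nat -> set N) (AB_point : is_point delta m h A B)
  (I : {set 'I_m.+1}) (I_type : is_BT_type delta A B I) :
  I != finset.set0.
Proof.
have strk := wint_strict Wk.
have piP := strict_pi strk; rewrite -/(wpi Wk) in piP.
have resk := strict_residue strk.
have [LA [LB [LAB I0 Im II]]] := I_type.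
have latA i im := (point_lattice AB_point (i := i) im).1.
have latB i im := (point_lattice AB_point (i := i) im).2.
have LamA i im := (LAB i im).1.
have LamB i im := (LAB i im).2.
have hullA i im := Lambda_hull (latA i im) (LamA i im).
have hullB i im := Lambda_hull (latB i im) (LamB i im).
have mm : (1 <= m <= m)%N by rewrite m_pos leqnn.
have m1 : (1 <= 1 <= m)%N by rewrite m_pos.
pose A' i := if i == m.+1 then scale_set (wpi Wk) (B m) else A i.
pose LA' i := if i == m.+1 then scale_set (wpi Wk) (LB m) else LA i.
pose B' i := if i is 0%N then A 1%N else B i.
pose LB' i := if i is 0%N then LA 1%N else LB i.
have A'E i : (i <= m)%N -> A' i = A i by rewrite /A'; case: eqP => // ->; rewrite ltnn.
have LA'E i : (i <= m)%N -> LA' i = LA i by rewrite /LA'; case: eqP => // ->; rewrite ltnn.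
have B'E i : (0 < i)%N -> B' i = B i by case: i.
have [e absorb] := latticeC_absorb (latB m mm) (LamB m mm).1.
have q_gt0 : (0 < #|resF F|)%N by apply/card_gt0P; exists 0.
have [i leim obs] : exists2 i, (i <= m)%N & forall b a, LB' i b -> LA' i.+1 a ->
    pi_ideal (wint Wk) (wpi Wk) (herm delta b a).
  apply: (@no_total_obstruction _ _ _ _ _ _ _
    resk piP q_gt0 (@wfrob_int _ _ _ _ Wk) (@wfrob_red _ _ _ _ Wk) (wfrob_pi Wk)
    N (tau (N := N)) (Ck (N := N)) (herm delta)
    (@tauD _ _ _ _ _ _ _ _ _ _ _ _ _ _ _ N) (@tauZ _ _ _ _ _ _ _ _ _ _ _ _ _ _ _ N)
    (Ck_submodule N) (@hermDl _ _ _ _ _ _ _ _ _ _ _ _ delta _ _ _ N)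
    (@hermZl _ _ _ _ _ _ _ _ _ _ _ _ delta _ _ _ N)
    (@hermDr _ _ _ _ _ _ _ _ _ _ _ _ delta _ _ _ N)
    (@hermZr _ _ _ _ _ _ _ _ _ _ _ _ delta _ _ _ N)
    (@herm_tau _ _ _ _ _ _ _ _ _ _ _ _ _ delta_frob _ _ _ N) m A' B' LA' LB' e) => //.
- move=> i im; have /andP[i_gt0 leim] := im; rewrite A'E // B'E //.
  have [lenA leA] := point_dualA AB_point im; have [lenB leB] := point_dualB AB_point im.
  by split=> //; [apply: (latticeCk_submodule (latA i im)).1 |
                  apply: (latticeCk_submodule (latB i im)).1].
- move=> i im; have /andP[i_gt0 leim] := im; rewrite A'E // B'E //.
  exact: (point_level AB_point im).1.
- move=> i im; have /andP[i_gt0 leim] := im; rewrite (A'E i) //.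
  have [ltim|gtim|eqim] := ltngtP i m; last 1 first.
  + by rewrite eqim /A' eqxx; apply: (point_level AB_point mm).1.
  + by rewrite A'E //; apply: (point_chain AB_point _).1; rewrite i_gt0.
  + by move: leim; rewrite leqNgt gtim.
- case=> [|i] ltim; first exact: (colength_sub (point_level AB_point m1).2).
  by apply: (point_chain AB_point _).2.
- by rewrite A'E.
- by rewrite LA'E.
- by rewrite /A' eqxx B'E.
- by rewrite /LA' eqxx; case: (m) m_pos.
- move=> i /andP[i_gt0]; rewrite leq_eqVlt => /orP[/eqP->|]; last first.
    by rewrite ltnS => leim; rewrite A'E // LA'E //; apply: hullA; rewrite i_gt0.
  rewrite /A' /LA' eqxx.
  apply: (tau_hull_scale resk (wfrob_pi Wk) (@tauZ _ _ _ _ _ _ _ _ _ _ _ _ _ _ _ N)).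
    exact: Ck_submodule.
  exact: hullB.
- case=> [|i] leim; [exact: hullA | exact: hullB].
- by case: (m) m_pos absorb.
have sub_hull (Z L : set N) : tau_hull (wint Wk) (tau (N := N)) (Ck (N := N)) Z L ->
  (Z `<=` rgen (wint Wk) L)%classic by case.
suff [l lI] : exists l, l \in I by apply/finset.set0Pn; exists l.
case: i leim obs => [|i] leim obs.
  (* At index 0, [LB' 0] is [LA 1], so the form is divisible by [pi] on [LA 1]; also pi^2 A_1^v < pi
     B_1 < A_1. *)
  exists ord0; apply/I0.
  apply: (vertexI card_Fq2 phi0_bij phi0_F (LamA _ m1).1 (sub_hull _ _ (hullA _ m1))).
    move=> v Cv Av; have [lenA _] := point_dualA AB_point m1.
    have [piBA _] := point_level AB_point m1.
    apply: piBA; exists (wpi Wk *: v); last by rewrite scalerA.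
    by apply: (colength_sub lenA); exists v.
  move=> b a Lb La; have [||y Oy ->] := obs b a; rewrite ?LA'E //.
  by rewrite expr1 mulKf.
move: leim; rewrite leq_eqVlt => /orP[/eqP eqim|ltim].
  (* At index m, [LA' m.+1] is [pi] times [LB m], so dividing by [pi] makes the form integral on
     [LB m]; also pi B_m^v < A_m < B_m. *)
  exists ord_max; apply/Im.
  apply: (vertexI card_Fq2 phi0_bij phi0_F (LamB _ mm).1 (sub_hull _ _ (hullB _ mm))).
    move=> v Cv Bv; have [lenB _] := point_dualB AB_point mm.
    apply: (colength_sub (point_level AB_point mm).2).
    by apply: (colength_sub lenB); exists v.
  move=> b a Lb La; rewrite expr0 invr1 mul1r.
  have Lb' : LB' i.+1 b by rewrite /LB' eqim.
  have La' : LA' i.+2 (wpi Wk *: a) by rewrite eqim /LA' eqxx; exists a.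
  have [y Oy] := obs _ _ Lb' La'.
  by rewrite hermZr wfrob_pi => /(mulfI piP) ->.
have im : (1 <= i.+1 < m)%N by [].
exists (Ordinal (leqW ltim)); apply/II => //= v Lv.
exists ((wpi Wk)^-1 *: v); last by rewrite scalerA divff ?scale1r.
split.
  apply: C_scale; first by rewrite fmorphV wfrob_pi.
  by apply: (latticeC_sub (LamB i.+1 (ltnW ltim)).1 Lv).
move=> w Lw; rewrite hermZl.
have [||y Oy ->] := obs v w; rewrite ?LA'E //.
by rewrite mulKf.
Qed.
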